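(* Let $X\in\mathbb{Z}^{n\times n}$ be a symmetric integral matrix and let $\zeta\in\mathbb{Z}^n$. Suppose that $\det(W_{X,\zeta})$ is square-free. Then $(X,\zeta)$ is characterized up to signed permutation by its $\Phi$-spectrum; that is, for every symmetric $Y\in\mathbb{Z}^{n\times n}$ and every $\eta\in\mathbb{Z}^n$ with $\Phi_{X,\zeta}=\Phi_{Y,\eta}$, there exists a signed permutation matrix $S$ with $SXS^{\mathsf T}=Y$ and $S\zeta=\eta$.
   Context: For a symmetric $X\in\mathbb{Z}^{n\times n}$ and $\zeta\in\mathbb{Z}^n$, the walk matrix is $W_{X,\zeta}=[\zeta,\,X\zeta,\,\ldots,\,X^{n-1}\zeta]\in\mathbb{Z}^{n\times n}$ (given by columns), and $\Phi_{X,\zeta}(\lambda,t)=\det(\lambda I-X-t\,\zeta\zeta^{\mathsf T})$, a polynomial in $\lambda,t$. A signed permutation matrix is a matrix of the form $S=PD$ with $P\in\{0,1\}^{n\times n}$ a permutation matrix and $D$ a diagonal matrix with diagonal entries $\pm1$. An integer $M\in\mathbb{Z}$ is square-free if there is no prime $p$ with $p^2\mid M$ (in particular $0$ is not square-free). *)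

(* Defs.v *)
From mathcomp Require Import all_boot all_order all_algebra all_fingroup.
Set Implicit Arguments.
Unset Strict Implicit.
Unset Printing Implicit Defensive.
Import GRing.Theory.
Local Open Scope ring_scope.

Definition symmetric_mx n (X : 'M[int]_n) : Prop := X^T = X.

Definition walk_mx n (X : 'M[int]_n) (zeta : 'cV[int]_n) : 'M[int]_n :=
  \matrix_(i < n, j < n) (X ^+ j *m zeta) i 0.

(* Z[lambda, t] is {poly {poly int}}: the outer variable 'X is lambda, and
   the inner one, seen as the constant 'X%:P, is t. *)
Definition Phi n (X : 'M[int]_n) (zeta : 'cV[int]_n) : {poly {poly int}} :=
  let cst (A : 'M[int]_n) : 'M[{poly {poly int}}]_n :=
    map_mx (fun a : int => a%:P%:P) A in
  \det ('X%:M - cst X - ('X%:P : {poly {poly int}}) *: cst (zeta *m zeta^T)).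

Definition signed_perm_mx n (S : 'M[int]_n) : Prop :=
  exists (P : 'M[int]_n) (d : 'rV[int]_n),
    [/\ is_perm_mx P,
        forall i, d 0 i = 1 \/ d 0 i = -1
      & S = P *m diag_mx d].

Definition square_free (M : int) : Prop :=
  forall p : nat, prime p -> ~ (p%:Z ^+ 2 %| M)%Z.

(* Main.v *)
(* The polynomial Phi determines the characteristic polynomial of X and, by the
   matrix determinant lemma, the form zeta^T adj(lambda - X) zeta, hence all
   moments zeta^T X^k zeta.  So the walk matrices A of (X, zeta) and B of
   (Y, eta) satisfy A^T A = B^T B, X A = A C and Y B = B C for one companion
   matrix C, and Q = B A^-1 = B adj(A) / det A is a rational orthogonal matrix
   conjugating X to Y.  It remains to see that B adj(A) vanishes modulo every
   prime p dividing det A.  Modulo p both A and B have corank 1, since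
   p^2 does not divide det A.  The kernels of A and B are lines spanned by
   eigenvectors e and f of C.  If B e <> 0, then B e spans the kernel of B^T
   (because B^T B e = A^T A e = 0) and is an eigenvector of Y; the relation
   adj(B) Y = C adj(B), with adj(B) of rank 1, forces its eigenvalue to be that
   of f.  Eigenspaces of a companion matrix are lines, so e is a multiple of f
   and B e = 0 after all.  Hence Q is integral, and an integral orthogonal
   matrix is a signed permutation. *)
Require Import Defs.
From mathcomp Require Import all_boot all_order all_algebra all_fingroup.
Set Implicit Arguments.
Unset Strict Implicit.
Unset Printing Implicit Defensive.
Import Order.TTheory GRing.Theory Num.Theory.
Local Open Scope ring_scope.

(** * Matrix determinant lemma and the coefficients of [Phi] in t *)

Lemma det_sub_rank1 (R : idomainType) n (M : 'M[R]_n) (u : 'cV[R]_n)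
    (v : 'rV[R]_n) t :
  \det M != 0 ->
  \det (M - t *: (u *m v)) = \det M - t * (v *m \adj M *m u) 0 0.
Proof.
(* The bordered matrix [T] is made block triangular in two ways; the second costs a factor [\det M],
   which [nzM] cancels. *)
move=> nzM; pose T := block_mx M (t *: u) v 1%:M.
have detT : \det T = \det (M - t *: (u *m v)).
  have: block_mx 1%:M (- (t *: u)) 0 1%:M *m T
        = block_mx (M - t *: (u *m v)) 0 v 1%:M.
    by rewrite mulmx_block !mul1mx !mul0mx !mulmx1 !add0r mulNmx -scalemxAl
      subrr.
  move/(congr1 determinant); rewrite det_mulmx det_lblock det_ublock.
  by rewrite !det1 !mul1r mulr1.
apply: (mulfI nzM); rewrite -detT.
have: block_mx 1%:M 0 (- (v *m \adj M)) (\det M)%:M *m T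
      = block_mx M (t *: u) 0 ((\det M)%:M - t *: (v *m \adj M *m u)).
  rewrite mulmx_block !mul1mx !mul0mx !addr0 mulmx1 mulNmx -(mulmxA v _ M)
    mul_adj_mx.
  by rewrite mul_mx_scalar mul_scalar_mx addNr mulNmx -scalemxAr addrC.
move/(congr1 determinant); rewrite det_mulmx det_lblock det_ublock det1 mul1r.
rewrite det_scalar1 => ->.
by rewrite [X in _ * \det X]mx11_scalar det_scalar1 !mxE mulr1n.
Qed.

(** The resolvent entry u^T (lambda - X)^-1 v, cleared of its denominator [char_poly X]. *)
Definition resolvent_form n (X : 'M[int]_n) (u v : 'cV[int]_n) : {poly int} :=
  ((map_mx polyC u)^T *m \adj (char_poly_mx X) *m map_mx polyC v) 0 0.

(** The update by t is of rank one, so [Phi] is affine in t and its two coefficients can be read off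
    separately; [map_poly polyC] embeds Z[lambda] as the polynomials free of t. *)
Lemma PhiE n (X : 'M[int]_n) (z : 'cV[int]_n) :
  Phi X z = map_poly polyC (char_poly X)
            - 'X%:P * map_poly polyC (resolvent_form X z z).
Proof.
have detE : \det (char_poly_mx (map_mx polyC X)) = map_poly polyC (char_poly X).
  exact: esym (map_char_poly _ _).
have nzd : \det (char_poly_mx (map_mx polyC X)) != 0.
  by rewrite monic_neq0 ?char_poly_monic.
rewrite -detE /Phi.
have cstE p q (A : 'M[int]_(p, q)) :
    map_mx (fun a : int => a%:P%:P) A = map_mx polyC (map_mx polyC A).
  by apply/matrixP=> i j; rewrite !mxE.
rewrite !cstE !map_mxM det_sub_rank1 //; congr (_ - _ * _).
rewrite -[_ - _]/(char_poly_mx _) -(map_char_poly_mx polyC X) -map_mx_adj.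
have cst2E p q (A : 'M[int]_(p, q)) :
    map_mx polyC (map_mx polyC A) = map_mx (map_poly polyC) (map_mx polyC A).
  by apply/matrixP=> i j; rewrite !mxE map_polyC.
by rewrite !cst2E -!map_mxM mxE /resolvent_form map_trmx.
Qed.

Lemma Phi_eq_char_poly n (X Y : 'M[int]_n) (z e : 'cV[int]_n) :
  Phi X z = Phi Y e -> char_poly X = char_poly Y.
Proof.
rewrite !PhiE => /polyP eqP; apply/polyP=> i.
by move/(congr1 (coefp 0)): (eqP i);
  rewrite /= !(coefB, coefCM, coefXM, coef_map, coefC) /= !subr0.
Qed.

Lemma Phi_eq_resolvent n (X Y : 'M[int]_n) (z e : 'cV[int]_n) :
  Phi X z = Phi Y e -> resolvent_form X z z = resolvent_form Y e e.
Proof.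
rewrite !PhiE => /polyP eqP; apply/polyP=> i.
move/(congr1 (coefp 1)): (eqP i).
by rewrite /= !(coefB, coefCM, coefXM, coef_map, coefC) /= !sub0r => /oppr_inj.
Qed.

Lemma size_det_le (R : comNzRingType) n (M : 'M[{poly R}]_n) :
  (forall i j, size (M i j) <= 2)%N -> (size (\det M) <= n.+1)%N.
Proof.
move=> sM; apply: (leq_trans (size_sum _ _ _)); apply/bigmax_leqP=> s _.
rewrite size_Msign (leq_trans (size_poly_prod_leq _ _)) // leq_subLR cardT
  size_enum_ord.
rewrite addnS ltnS addnn -muln2.
apply: (@leq_trans (\sum_(i < n) 2)); first exact: leq_sum.
by rewrite sum_nat_const card_ord.
Qed.

(** The entries of the adjugate are, up to sign, minors of order n - 1 of a matrix with entries of
    degree at most 1. *)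
Lemma size_resolvent_form n (X : 'M[int]_n) (u v : 'cV[int]_n) :
  (size (resolvent_form X u v) <= n)%N.
Proof.
have sizeMC (p q : {poly int}) : (size q <= 1)%N -> (size (p * q)%R <= size
  p)%N.
  move=> sq; rewrite (leq_trans (size_polyMleq _ _)) //.
  by rewrite -subn1 leq_subLR addnC leq_add2r.
case: n => [|n] in X u v *.
  by rewrite /resolvent_form !mxE big_ord0 size_poly0.
rewrite /resolvent_form mxE (leq_trans (size_sum _ _ _)) //.
apply/bigmax_leqP=> j _; rewrite !mxE.
rewrite (leq_trans (sizeMC _ _ (size_polyC_leq1 _))) //.
rewrite (leq_trans (size_sum _ _ _)) //; apply/bigmax_leqP=> i _; rewrite !mxE.
rewrite mulrC (leq_trans (sizeMC _ _ (size_polyC_leq1 _))) //.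
rewrite size_Msign size_det_le // => k l; rewrite !mxE.
rewrite (leq_trans (size_polyD _ _)) // geq_max size_polyN.
rewrite (leq_trans (size_polyC_leq1 _)) // andbT.
by case: (_ == _); rewrite ?mulr1n ?mulr0n ?size_polyX ?size_poly0.
Qed.

(** Factor lambda^k - X^k through lambda - X, multiply by the adjugate of lambda - X, and sandwich
    between u^T and v. *)
Lemma resolvent_moments n (X : 'M[int]_n.+1) (u v : 'cV[int]_n.+1) k :
  char_poly X * \sum_(i < k) 'X^(k.-1 - i) * ((u^T *m X ^+ i *m v) 0 0)%:P
  = 'X^k * resolvent_form X u v - resolvent_form X u (X ^+ k *m v).
Proof.
pose cX := map_mx polyC X; pose x : 'M[{poly int}]_n.+1 := 'X%:M.
have cxy : GRing.comm x cX by apply: esym (scalar_mxC 'X cX).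
have xE i : x ^+ i = ('X^i)%:M by rewrite -rmorphXn.
have cXE i : cX ^+ i = map_mx polyC (X ^+ i) by rewrite -rmorphXn.
have adjE : \adj (char_poly_mx X) *m (x ^+ k - cX ^+ k)
    = char_poly X *: \sum_(i < k) 'X^(k.-1 - i) *: map_mx polyC (X ^+ i).
  rewrite subrXX_comm // [LHS](mulmxA _ (char_poly_mx X)) mul_adj_mx
    mul_scalar_mx.
  congr (_ *: _); apply: eq_bigr => i _.
  by rewrite xE cXE [LHS]mul_scalar_mx.
have := congr1 (fun M => ((map_mx polyC u)^T *m M *m map_mx polyC v) 0 0) adjE.
rewrite /= xE cXE mulmxBr mul_mx_scalar !(mulmxBr, mulmxBl) -!(scalemxAr,
  scalemxAl).
rewrite mulmx_sumr mulmx_suml => E.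
transitivity ((char_poly X *: \sum_(i < k) (map_mx polyC u)^T
    *m ('X^(k.-1 - i) *: map_mx polyC (X ^+ i)) *m map_mx polyC v) 0 0).
  rewrite mxE summxE; congr (_ * _); apply: eq_bigr => i _.
  by rewrite -scalemxAr -scalemxAl mxE map_trmx -!map_mxM !mxE.
by rewrite -E /resolvent_form map_mxM !mulmxA [LHS]mxE [X in X + _]mxE [X in _
  + X]mxE.
Qed.

(* Modulo terms of degree at most n, the resolvent form of X times 'X^k is the
   characteristic polynomial times a generating polynomial of the moments; since
   the characteristic polynomial is monic, that generating polynomial is a
   quotient of Euclidean division, determined by Phi. *)
Lemma Phi_eq_moments n (X Y : 'M[int]_n.+1) (z e : 'cV[int]_n.+1) k :
  Phi X z = Phi Y e -> z^T *m X ^+ k *m z = e^T *m Y ^+ k *m e.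
Proof.
move=> eqPhi; apply/matrixP=> i j; rewrite !ord1 {i j}.
pose S (A : 'M[int]_n.+1) (w : 'cV[int]_n.+1) : {poly int} :=
  \sum_(i < k.+1) 'X^(k - i) * ((w^T *m A ^+ i *m w) 0 0)%:P.
(* Only the last summand, with exponent k - i = 0, has a constant term. *)
have S0 A w : (S A w)`_0 = (w^T *m A ^+ k *m w) 0 0.
  rewrite coef_sum big_ord_recr /= subnn mul1r coefC big1 ?add0r // => i _.
  by rewrite coefMC coefXn eq_sym subn_eq0 leqNgt ltn_ord mul0r.
suff eqS : S X z = S Y e by rewrite -!S0 eqS.
have SX := resolvent_moments X z z k.+1.
have SY := resolvent_moments Y e e k.+1.
rewrite -(Phi_eq_char_poly eqPhi) -(Phi_eq_resolvent eqPhi) in SY.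
(* A nonzero difference times the monic [char_poly X] has size at least n + 2, yet it equals a
   difference of two forms of size at most n + 1. *)
apply/eqP; rewrite -subr_eq0; apply/negPn/negP => nzS.
have := size_monicM (char_poly_monic X) nzS.
rewrite size_char_poly mulrBr SX SY opprB addrC subrKA => sz.
have : (size (resolvent_form Y e (Y ^+ k.+1 *m e)
              - resolvent_form X z (X ^+ k.+1 *m z))%R <= n.+1)%N.
  by rewrite (leq_trans (size_polyD _ _)) // geq_max size_polyN
    !size_resolvent_form.
by rewrite sz addSn /= -[leqRHS]addn0 leq_add2l leqn0 size_poly_eq0 (negPf nzS).
Qed.

(** * Walk matrices and the companion matrix *)

Lemma walk_mxE n (X : 'M[int]_n) z i j : walk_mx X z i j = (X ^+ j *m z) i 0.
Proof. by rewrite mxE. Qed.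

Lemma tr_exp_mx n (X : 'M[int]_n) k : (X ^+ k)^T = X^T ^+ k.
Proof. by elim: k => [|k IH]; rewrite ?trmx1 // exprS exprSr trmx_mul IH. Qed.

(** Symmetry moves X^i across the inner product, so the Gram matrix is the Hankel matrix of the
    moments. *)
Lemma walk_gramE n (X : 'M[int]_n) z i j : symmetric_mx X ->
  ((walk_mx X z)^T *m walk_mx X z) i j = (z^T *m X ^+ (i + j) *m z) 0 0.
Proof.
move=> symX; rewrite exprD -mulmxE !mulmxA -(mulmxA _ (X ^+ j)).
have -> : z^T *m X ^+ i = (X ^+ i *m z)^T by rewrite trmx_mul tr_exp_mx symX.
rewrite mxE [RHS]mxE; apply: eq_bigr => k _.
by rewrite [in LHS]mxE [in RHS]mxE !walk_mxE.
Qed.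

(* Transpose of [companionmx], with an arbitrary coefficient function so
   that its size does not depend on a polynomial. *)
Definition companion (R : pzRingType) n (c : nat -> R) : 'M[R]_n.+1 :=
  \matrix_(i, j) if j == n :> nat then - c i else (i == j.+1 :> nat)%:R.

Lemma map_companion (R S : pzRingType) (f : {rmorphism R -> S}) n (c : nat ->
  R) :
  map_mx f (companion n c) = companion n (f \o c).
Proof.
by apply/matrixP=> i j; rewrite !mxE; case: eqP; rewrite ?rmorphN ?rmorph_nat.
Qed.

Lemma mul_walk_companion n (X : 'M[int]_n.+1) z :
  X *m walk_mx X z = walk_mx X z *m companion n (fun i => (char_poly X)`_i).
Proof.
apply/matrixP=> i j; transitivity ((X ^+ j.+1 *m z) i 0).
  rewrite exprS -mulmxE -mulmxA [LHS]mxE [RHS]mxE.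
  by apply: eq_bigr => k _; rewrite walk_mxE.
rewrite [RHS]mxE; under eq_bigr => k _ do rewrite walk_mxE [companion _ _ _
  _]mxE.
have [jn|jn] := eqVneq (j : nat) n; last first.
  have jlt : (j.+1 < n.+1)%N by rewrite ltn_neqAle eqSS jn ltn_ord.
  rewrite (bigD1 (Ordinal jlt)) //= eqxx mulr1 big1 ?addr0 // => k.
  by rewrite -val_eqE /= => /negPf ->; rewrite mulr0.
(* Multiplication by X shifts the columns; in the last one, Cayley-Hamilton expresses X^(n+1) by
   lower powers. *)
have := Cayley_Hamilton X; rewrite -{1}[char_poly X]coefK poly_def raddf_sum /=.
rewrite size_char_poly big_ord_recr /=.
under eq_bigr do rewrite linearZ rmorphXn /= horner_mx_X.
rewrite linearZ rmorphXn /= horner_mx_X.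
have := char_poly_monic X;
  rewrite monicE lead_coefE size_char_poly /= => /eqP ->.
rewrite scale1r jn addrC => /eqP; rewrite addr_eq0 => /eqP ->.
rewrite mulNmx mxE mulmx_suml summxE -sumrN; apply: eq_bigr => k _.
by rewrite -scalemxAl mxE mulrN mulrC.
Qed.

(** Once the last coordinate is 0, row i of the equation reads x_(i-1) = l x_i, so zeros propagate
    down from the last index. Thus an eigenvector is determined by its eigenvalue and last
    coordinate. *)
Lemma companion_eigen_eq0 (K : fieldType) n (c : nat -> K) (x : 'cV[K]_n.+1) l :
  companion n c *m x = l *: x -> x ord_max 0 = 0 -> x = 0.
Proof.
move=> Cx xn; suff H k : (k <= n)%N -> x (inord (n - k)) 0 = 0.
  apply/colP=> i; rewrite mxE -(H (n - i)%N) ?leq_subr // subKn ?inord_val //.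
  by rewrite -ltnS.
elim: k => [|k IH] kn.
  by rewrite subn0 -[RHS]xn; congr (x _ _); apply/val_inj; rewrite /= inordK.
move/colP/(_ (inord (n - k))): Cx; rewrite [in RHS]mxE (IH (ltnW kn)) mulr0 mxE.
have lt1 : (n - k.+1 < n)%N by rewrite ltn_subrL (leq_trans _ kn).
rewrite (bigD1 (inord (n - k.+1))) //= !mxE !inordK ?ltnS ?leq_subr //.
rewrite (ltn_eqF lt1) subnSK // eqxx mul1r big1 ?addr0 // => j.
rewrite -val_eqE /= inordK ?ltnS ?leq_subr // => jk; rewrite mxE.
case: eqP => [jn|_].
  rewrite (_ : j = ord_max) ?xn ?mulr0 //; exact: val_inj.
by rewrite inordK ?ltnS ?leq_subr // -subnSK // eqSS eq_sym (negPf jk) mul0r.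
Qed.

(** * Kernels of matrices of corank at most 1 over a field *)

Lemma corank1_kernel (K : fieldType) n (A : 'M[K]_n.+1) (x y : 'cV[K]_n.+1) :
  (n <= \rank A)%N -> A *m x = 0 -> A *m y = 0 -> x != 0 ->
  exists c, y = c *: x.
Proof.
move=> rA Ax Ay nzx.
have rk : (\rank (kermx A^T) <= 1)%N by rewrite mxrank_ker mxrank_tr leq_subLR
  addn1.
have subk (w : 'cV_n.+1) : A *m w = 0 -> (w^T <= kermx A^T)%MS.
  by move=> Aw; apply/sub_kermxP; rewrite -trmx_mul Aw trmx0.
have rx : \rank x^T = 1%N by rewrite rank_rV -trmx0 (inj_eq trmx_inj) nzx.
have eqx : (x^T == kermx A^T)%MS.
  by rewrite -(geq_leqif (mxrank_leqif_eq (subk x Ax))) rx.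
have /sub_rVP[c /(congr1 trmx)] : (y^T <= x^T)%MS.
  by rewrite (eqmxP eqx) subk.
by rewrite linearZ /= !trmxK => ->; exists c.
Qed.

Lemma exists_col_neq0 (R : pzSemiRingType) m n (A : 'M[R]_(m, n)) :
  A != 0 -> exists j, col j A != 0.
Proof.
move=> nzA; apply/existsP; rewrite -negb_forall;
  apply: contra nzA => /forallP H.
apply/eqP/matrixP=> i j; have /eqP/colP/(_ i) := H j; by rewrite !mxE.
Qed.

Lemma mul_mx_col (R : pzSemiRingType) m n q (A : 'M[R]_(m, n)) (B : 'M[R]_(n,
  q)) j :
  A *m col j B = col j (A *m B).
Proof. by rewrite !colE mulmxA. Qed.

(** To be applied to reductions modulo p, with [D] the reduction of [\adj B]. *)
Lemma intertwiner_eq0 (K : fieldType) n (A B D X Y : 'M[K]_n.+1) (c : nat ->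
  K) :
    X *m A = A *m companion n c -> Y *m B = B *m companion n c -> Y^T = Y ->
    A^T *m A = B^T *m B -> (n <= \rank A)%N -> (n <= \rank B)%N ->
    B *m D = 0 -> D *m B = 0 -> D != 0 -> D *m Y = companion n c *m D ->
  forall e : 'cV[K]_n.+1, A *m e = 0 -> B *m e = 0.
Proof.
move=> XA YB symY gram rA rB BD DB nzD DY e Ae;
  set C := companion n c in XA YB DY.
apply/eqP/negPn/negP => nzBe; set w := B *m e in nzBe.
have nze : e != 0 by apply: contraNneq nzBe => e0; rewrite /w e0 mulmx0.
have [l Ce] : exists l, C *m e = l *: e.
  by apply: (corank1_kernel rA Ae _ nze); rewrite mulmxA -XA -mulmxA Ae mulmx0.
have Yw : Y *m w = l *: w by rewrite mulmxA YB -mulmxA Ce -scalemxAr.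
have [j nzf] := exists_col_neq0 nzD; set f := col j D in nzf.
have BDcol k : B *m col k D = 0 by rewrite mul_mx_col BD; apply/colP=> i;
  rewrite !mxE.
have [m Cf] : exists m, C *m f = m *: f.
  by apply: (corank1_kernel rB (BDcol j) _ nzf);
    rewrite mulmxA -YB -mulmxA BDcol mulmx0.
(* Every column of [D] is a multiple of the eigenvector [f]. *)
have CD : C *m D = m *: D.
  apply/matrixP=> i k.
  have [a ka] := corank1_kernel rB (BDcol j) (BDcol k) nzf.
  have : C *m col k D = m *: col k D by rewrite ka -scalemxAr -/f Cf !scalerA
    mulrC.
  by rewrite mul_mx_col => /colP/(_ i); rewrite !mxE.
have [i nzr] : exists i, col i D^T != 0.
  apply: exists_col_neq0; apply: contra_neq nzD => /(congr1 trmx).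
  by rewrite trmxK trmx0.
have Br : B^T *m col i D^T = 0.
  by rewrite mul_mx_col -trmx_mul DB; apply/colP=> k; rewrite !mxE.
(* Both [w] and a nonzero row of [D] lie in the kernel of [B^T], a line, so [Y] has the same
   eigenvalue on them. *)
have Bw : B^T *m w = 0 by rewrite mulmxA -gram -mulmxA Ae mulmx0.
have rBT : (n <= \rank B^T)%N by rewrite mxrank_tr.
have [a wr] := corank1_kernel rBT Br Bw nzr.
have Yr : Y *m col i D^T = m *: col i D^T.
  rewrite mul_mx_col -{1}symY -trmx_mul DY CD.
  by apply/colP=> k; rewrite !mxE.
have lm : l = m.
  apply/eqP; rewrite -subr_eq0; apply/negPn/negP => nz.
  have : (l - m) *: w == 0.
    by rewrite scalerBl -Yw wr -scalemxAr Yr !scalerA mulrC subrr.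
  by rewrite scaler_eq0 (negPf nz) (negPf nzBe).
have nzfn : f ord_max 0 != 0.
  by apply: contraNneq nzf => /(companion_eigen_eq0 Cf) ->.
(* The factor makes the last coordinates of both sides agree. *)
have ef : e = (e ord_max 0 / f ord_max 0) *: f.
  apply/eqP; rewrite -subr_eq0; apply/eqP.
  apply: (@companion_eigen_eq0 _ _ c _ m).
    by rewrite mulmxBr -scalemxAr Cf Ce lm scalerBr !scalerA [m * _]mulrC.
  by rewrite mxE [X in _ + X]mxE [X in - X]mxE divfK ?subrr.
by rewrite /w ef -scalemxAr BDcol scaler0 eqxx in nzBe.
Qed.


(** * Reduction modulo a prime *)

Definition mxFp p m n (M : 'M[int]_(m, n)) : 'M['F_p]_(m, n) := map_mx intr M.

Lemma mxFpM p m n q (M : 'M[int]_(m, n)) (N : 'M[int]_(n, q)) :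
  mxFp p (M *m N) = mxFp p M *m mxFp p N.
Proof. exact: map_mxM. Qed.

Lemma mxFp_tr p m n (M : 'M[int]_(m, n)) : mxFp p M^T = (mxFp p M)^T.
Proof. by rewrite /mxFp map_trmx. Qed.

Lemma dvdz_Fp p (a : int) : prime p -> (p%:Z %| a)%Z = ((a%:~R : 'F_p) == 0).
Proof. by move=> p_pr; exact: dvdz_pcharf (pchar_Fp p_pr) a. Qed.

Lemma mxFp_scalar_eq0 p n (a : int) :
  prime p -> (p%:Z %| a)%Z -> mxFp p (a%:M : 'M_n) = 0.
Proof.
move=> p_pr; rewrite dvdz_Fp // => /eqP a0; rewrite /mxFp map_scalar_mx /= a0.
by apply/matrixP=> k l; rewrite !mxE mul0rn.
Qed.

Lemma mxFp_eq0 p m n (A : 'M[int]_(m, n)) :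
  prime p -> mxFp p A = 0 -> exists G : 'M[int]_(m, n), A = p%:Z *: G.
Proof.
move=> p_pr A0; exists (\matrix_(i, j) (A i j %/ p)%Z); apply/matrixP=> i j.
rewrite !mxE mulrC divzK // dvdz_Fp //; have /matrixP/(_ i j) := A0.
by rewrite !mxE => ->.
Qed.

(** Column operations modulo p, lifted to an integral [L] with determinant prime to p, make the last
    n - r columns of [A *m L] divisible by p. *)
Lemma dvdz_det_rank p n (A : 'M[int]_n) :
  prime p -> (p%:Z ^+ (n - \rank (mxFp p A)) %| \det A)%Z.
Proof.
move=> p_pr; set Ap := mxFp p A; set r := \rank Ap.
pose R := invmx (row_ebase Ap).
pose L : 'M[int]_n := \matrix_(i, j) (R i j : nat)%:Z.
have LR : mxFp p L = R.
  by apply/matrixP=> i j; rewrite !mxE -pmulrn natr_Zp.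
have nzL : ~~ (p%:Z %| \det L)%Z.
  by rewrite dvdz_Fp // -det_map_mx -/(mxFp p L) LR -unitfE -unitmxE
    unitmx_inv row_ebase_unit.
pose d : 'rV[int]_n := \row_j (if (j < r)%N then 1 else p%:Z).
have dAL j i : (d ord0 j %| (A *m L) i j)%Z.
  rewrite [d _ _]mxE; case: ltnP => [_|rj]; first exact: dvd1z.
  rewrite dvdz_Fp //; have : mxFp p (A *m L) = col_ebase Ap *m pid_mx r.
    by rewrite mxFpM LR -/Ap -{1}[Ap]mulmx_ebase mulmxK ?row_ebase_unit.
  move/matrixP/(_ i j); rewrite [LHS]mxE => ->.
  rewrite mxE big1 // => k _; rewrite mxE; case: eqP => [->|];
    last by rewrite mulr0.
  by rewrite ltnNge rj mulr0.
pose N : 'M[int]_n := \matrix_(i, j) ((A *m L) i j %/ d ord0 j)%Z.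
have detE : \det A * \det L = \det N * p%:Z ^+ (n - r).
  rewrite -det_mulmx (_ : A *m L = N *m diag_mx d).
    rewrite det_mulmx det_diag; congr (_ * _).
    rewrite -prodr_const_nat big_geq_mkord [RHS]big_mkcond /=;
      apply: eq_bigr => j _.
    by rewrite mxE leqNgt if_neg.
  apply/matrixP=> i j; rewrite mul_mx_diag [RHS]mxE [N i j]mxE divzK //.
have : (p%:Z ^+ (n - r) %| \det A * \det L)%Z by rewrite detE dvdz_mull.
rewrite Gauss_dvdzl //; case: (n - r)%N => [|k];
  first by rewrite expr0 coprimezE coprime1n.
by rewrite coprimez_pexpl // coprimezE prime_coprime.
Qed.

Lemma corank1_mod_sqfree p n (A : 'M[int]_n.+1) :
  prime p -> ~~ (p%:Z ^+ 2 %| \det A)%Z -> (n <= \rank (mxFp p A))%N.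
Proof.
move=> p_pr; apply: contraR; rewrite -ltnNge => rn.
apply: dvdz_trans (dvdz_det_rank A p_pr).
by apply: dvdz_exp2l; rewrite ltn_subRL addn1 ltnS.
Qed.

(** If adj B = p G and det B = p m, then B G = m I; taking determinants, p divides m^n, hence m, and
    p^2 divides det B. *)
Lemma mxFp_adj_neq0 p n (B : 'M[int]_n) :
  prime p -> (p%:Z %| \det B)%Z -> ~~ (p%:Z ^+ 2 %| \det B)%Z ->
  mxFp p (\adj B) != 0.
Proof.
move=> p_pr pB; apply: contraNneq => /(mxFp_eq0 p_pr)[G adjE].
case/dvdzP: pB => m detE.
have nzp : p%:Z != 0 by rewrite eqz_nat -lt0n prime_gt0.
have : B *m G = m%:M.
  have := mul_mx_adj B; rewrite adjE detE mulrC -scalemxAr => H.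
  by apply: (scalemx_inj nzp); rewrite H scale_scalar_mx.
move/(congr1 determinant); rewrite det_mulmx det_scalar => mE.
have : (p%:Z %| m ^+ n)%Z by rewrite -mE detE mulrC mulrA dvdz_mull.
rewrite dvdz_Fp // rmorphXn expf_eq0 => /andP[_]; rewrite -dvdz_Fp // => pm.
by rewrite detE dvdz_mul.
Qed.

(** * Square-free divisors and integral orthogonal matrices *)

Lemma sqfree_dvdz (d m : int) : square_free d ->
  (forall p : nat, prime p -> (p%:Z %| d)%Z -> (p%:Z %| m)%Z) -> (d %| m)%Z.
Proof.
move=> sqf dm; have d_gt0 : (0 < `|d|)%N.
  rewrite absz_gt0; apply/eqP=> d0; apply: (sqf 2) => //.
  by rewrite d0 dvdz0.
rewrite dvdzE; apply/(dvdn_partP _ d_gt0) => p;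
  rewrite mem_primes => /and3P[p_pr _ pd].
have pm := dm p p_pr pd; rewrite p_part.
case: (leqP (logn p `|d|) 1) => [l1|l2]; last first.
  case: (sqf p p_pr); rewrite dvdzE abszX absz_nat.
  exact: dvdn_trans (dvdn_exp2l p l2) (pfactor_dvdnn p _).
by apply: dvdn_trans pm; rewrite -[X in (_ %| X)%N]expn1 dvdn_exp2l.
Qed.

Lemma sum_sqr_eq1 (I : finType) (x : I -> int) : \sum_i x i ^+ 2 = 1 ->
  exists i, (x i = 1 \/ x i = -1) /\ forall k, k != i -> x k = 0.
Proof.
move=> sx; have /existsP[i nzi] : [exists i, x i != 0].
  rewrite -negb_forall; apply/negP => /forallP x0.
  by move: sx; rewrite big1 // => i _; rewrite (eqP (x0 i)) expr0n.
exists i; move: sx; rewrite (bigD1 i) //=.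
have rest_ge0 : 0 <= \sum_(j | j != i) x j ^+ 2.
  by apply: sumr_ge0 => j _; apply: sqr_ge0.
have xi_ge1 : 1 <= x i ^+ 2 by rewrite -gtz0_ge1 lt0r sqr_ge0 sqrf_eq0 nzi.
move=> sx; have rest0 : \sum_(j | j != i) x j ^+ 2 = 0.
  by apply/eqP; rewrite eq_le rest_ge0 andbT -(lerD2l (x i ^+ 2)) sx addr0.
split; last first.
  move=> k ki; apply/eqP; rewrite -sqrf_eq0; apply/eqP.
  by apply: (psumr_eq0P _ rest0) => // j _; apply: sqr_ge0.
by move/eqP: sx; rewrite rest0 addr0 sqrf_eq1 => /orP[] /eqP; [left|right].
Qed.

(** Rows and columns are integral unit vectors, so each has a single nonzero entry, equal to 1 or
    -1. *)
Lemma orthogonal_int_signed_perm n (S : 'M[int]_n) :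
  S^T *m S = 1%:M -> signed_perm_mx S.
Proof.
move=> StS; have SSt := mulmx1C StS.
have rowP i : exists j, (S i j = 1 \/ S i j = -1) /\ forall k, k != j -> S i k
  = 0.
  apply: (sum_sqr_eq1 (x := S i)); move/matrixP/(_ i i): SSt.
  by rewrite !mxE eqxx mulr1n => <-; apply: eq_bigr => j _; rewrite mxE.
have colP j : exists i, (S i j = 1 \/ S i j = -1) /\ forall k, k != i -> S k j
  = 0.
  apply: (sum_sqr_eq1 (x := S^~ j)); move/matrixP/(_ j j): StS.
  by rewrite !mxE eqxx mulr1n => <-; apply: eq_bigr => i _; rewrite mxE.
have [f fP] := fin_all_exists rowP.
have nzf i : S i (f i) != 0 by case: (fP i) => -[] ->.
have f_inj : injective f.
  move=> i i' ff; have [k [_ kP]] := colP (f i).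
  have -> : i = k by apply: contraNeq (nzf i) => /kP ->.
  by apply/esym; apply: contraNeq (nzf i') => /kP; rewrite ff => ->.
(* [s] sends a row to the column of its nonzero entry; the diagonal factor is indexed by columns,
   hence the inverse of [s]. *)
pose s := perm f_inj; exists (perm_mx s), (\row_j S (s^-1%g j) j); split.
- exact: perm_mx_is_perm.
- move=> j; rewrite mxE -{2 4}(permKV s j) [s _]permE; by case: (fP (s^-1%g j)).
apply/matrixP=> i j; rewrite mul_mx_diag !mxE permE.
have [fij|fij] := eqVneq (f i) j.
  by rewrite mul1r -fij -(permE f_inj) -/s permK.
by rewrite mul0r; case: (fP i) => _; apply; rewrite eq_sym.
Qed.

(** Multiply by [\adj B] on both sides and cancel [\det B]. *)
Lemma adj_intertwine (R : idomainType) n (B Y C : 'M[R]_n) :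
  \det B != 0 -> Y *m B = B *m C -> \adj B *m Y = C *m \adj B.
Proof.
move=> nzB YB; apply: (scalemx_inj nzB).
have := congr1 (fun M => \adj B *m M *m \adj B) YB.
rewrite /= -!mulmxA mul_mx_adj !mulmxA mul_adj_mx mul_mx_scalar mul_scalar_mx.
by rewrite -scalemxAl.
Qed.

Theorem theorem2p12 (n : nat) (X : 'M[int]_n) (zeta : 'cV[int]_n)
    (X_sym : symmetric_mx X)
    (detW_sqfree : square_free (\det (walk_mx X zeta))) :
  forall (Y : 'M[int]_n) (eta : 'cV[int]_n),
    symmetric_mx Y -> Phi X zeta = Phi Y eta ->
    exists S : 'M[int]_n,
      [/\ signed_perm_mx S, S *m X *m S^T = Y & S *m zeta = eta].
Proof.
move=> Y eta Y_sym eqPhi.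
case: n => [|n] in X zeta X_sym detW_sqfree Y eta Y_sym eqPhi *.
  by exists 1%:M; split; rewrite ?[LHS]flatmx0 ?[RHS]flatmx0 //;
    apply: orthogonal_int_signed_perm; rewrite trmx1 mulmx1.
set A := walk_mx X zeta in detW_sqfree; pose B := walk_mx Y eta.
pose c i := (char_poly X)`_i.
have XA : X *m A = A *m companion n c by apply: mul_walk_companion.
have YB : Y *m B = B *m companion n c.
  by rewrite /c (Phi_eq_char_poly eqPhi); apply: mul_walk_companion.
have gram : A^T *m A = B^T *m B.
  by apply/matrixP=> i j; rewrite !walk_gramE // (Phi_eq_moments _ eqPhi).
have detB : \det B = \det A \/ \det B = - \det A.
  have /eqP := congr1 determinant gram;
    rewrite !det_mulmx !det_tr -!expr2 eqf_sqr.
  by case/orP => /eqP ->; [left|right; rewrite opprK].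
have dvdB m : (m %| \det B)%Z = (m %| \det A)%Z.
  by case: detB => ->; rewrite // !dvdzE abszN.
have nzA : \det A != 0.
  by apply/eqP => d0; case: (detW_sqfree 2) => //; rewrite d0 dvdz0.
have nzB : \det B != 0 by case: detB => ->; rewrite ?oppr_eq0.
(* Integrality of B A^-1, tested one prime at a time. *)
have dF i j : (\det A %| (B *m \adj A) i j)%Z.
  apply: sqfree_dvdz => // p p_pr pA.
  have p2A : ~~ (p%:Z ^+ 2 %| \det A)%Z by apply/negP/detW_sqfree.
  have p2B : ~~ (p%:Z ^+ 2 %| \det B)%Z by rewrite dvdB.
  have pB : (p%:Z %| \det B)%Z by rewrite dvdB.
  pose cp := (intr : int -> 'F_p) \o c.
  have fC : mxFp p (companion n c) = companion n cp by apply: map_companion.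
  (* Modulo p, the columns of [\adj A] lie in the kernel of [A], because A adj(A) = det(A) I
     vanishes. *)
  have Be0 : mxFp p B *m col j (mxFp p (\adj A)) = 0.
    apply: (@intertwiner_eq0 _ _ (mxFp p A) (mxFp p B)
             (mxFp p (\adj B)) (mxFp p X) (mxFp p Y) cp);
      rewrite -?fC -?mxFp_tr -?mxFpM.
    - by rewrite XA.
    - by rewrite YB.
    - by rewrite Y_sym.
    - by rewrite gram.
    - exact: corank1_mod_sqfree.
    - exact: corank1_mod_sqfree.
    - by rewrite mul_mx_adj mxFp_scalar_eq0.
    - by rewrite mul_adj_mx mxFp_scalar_eq0.
    - exact: mxFp_adj_neq0.
    - by rewrite (adj_intertwine nzB YB).
    - by rewrite mul_mx_col -mxFpM mul_mx_adj mxFp_scalar_eq0 //;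
      apply/colP=> k; rewrite !mxE.
  rewrite dvdz_Fp //; move/colP/(_ i): Be0.
  by rewrite mul_mx_col -mxFpM ![col _ _ _ _]mxE mxE => ->; rewrite mxE.
pose S : 'M[int]_n.+1 := \matrix_(i, j) ((B *m \adj A) i j %/ \det A)%Z.
have SE : \det A *: S = B *m \adj A.
  by apply/matrixP=> i j; rewrite mxE [S i j]mxE mulrC divzK.
have SA : S *m A = B.
  apply: (scalemx_inj nzA).
  by rewrite scalemxAl SE -mulmxA mul_adj_mx mul_mx_scalar.
have StS : S^T *m S = 1%:M.
  (* One factor [\det A] for each copy of [S] turns the left side into adj(A)^T B^T B adj(A), where
     [gram] replaces B by A. *)
  apply: (scalemx_inj nzA); apply: (scalemx_inj nzA).
  rewrite scalemxAr SE scalemxAl -linearZ /= SE trmx_mul -mulmxA [B^T *m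
    _]mulmxA -gram.
  rewrite -mulmxA mul_mx_adj mulmxA -trmx_mul mul_mx_adj tr_scalar_mx.
  by rewrite mul_scalar_mx !scale_scalar_mx mulr1.
exists S; split; first exact: orthogonal_int_signed_perm.
- have SX : S *m X = Y *m S.
    apply: (scalemx_inj nzA).
    rewrite scalemxAl SE scalemxAr SE -mulmxA (adj_intertwine nzA XA).
    by rewrite !mulmxA YB.
  by rewrite SX -mulmxA (mulmx1C StS) mulmx1.
(* The vector is the first column of its walk matrix, so [SA] carries [zeta] to [eta]. *)
- have colE (Z : 'M[int]_n.+1) z : z = col 0 (walk_mx Z z).
    by apply/colP=> i; rewrite mxE walk_mxE expr0 mul1mx.
  by rewrite (colE X zeta) (colE Y eta) mul_mx_col SA.
Qed.
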